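(* Assume that every matrix $\mathbf M'_l$ is symmetric positive definite, and define $$\mathbf M'_{\max}:=\mathbf M'_0+w_{\max}\sum_{e\in\mathcal E_{\mathrm c}}\mathbf a_e\mathbf a_e^\top,\qquad \lambda_{\min}^{\mathrm{lower}}:=\lambda_{\min}(\mathbf M'_0)>0,\qquad \lambda_{\max}^{\mathrm{upper}}:=\lambda_{\max}(\mathbf M'_{\max}).$$ Then the local policy ratio admits the uniform lower bound $$\rho_l\ \ge\ \frac{w_{\min}}{w_{\max}}\cdot\frac{(\lambda_{\min}^{\mathrm{lower}})^2}{(\lambda_{\max}^{\mathrm{upper}})^2}\cdot\frac{1}{1+\dfrac{2w_{\max}}{\lambda_{\min}^{\mathrm{lower}}}}\;=:\;\rho_{\min},$$ valid whenever the local policy ratio $\rho_l$ is defined.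
   Context: Setting. $\mathcal G$ is an undirected graph on $n$ nodes $v_1,\dots,v_n$ with base edge set $\mathcal E_{\mathrm b}$ (no self-loops), fixed positive base edge weights and weighted Laplacian $\mathbf L_{\mathrm b}$. $\mathcal E_{\mathrm c}$ is a set of $p$ candidate edges (unordered pairs of distinct nodes, disjoint from $\mathcal E_{\mathrm b}$) with per-unit costs $0<c_e<\infty$. For $e=\{v_i,v_j\}$, $\mathbf a_e\in\mathbb R^n$ has $i$-th entry $1$, $j$-th entry $-1$ (arbitrary orientation), zeros elsewhere. Budget $C>0$, target cardinality $k\in\{1,\dots,p\}$, weight bounds $0<w_{\min}\le w_{\max}$. $\lambda_{\min},\lambda_{\max}$ denote the smallest and largest eigenvalues of a symmetric matrix. States. For $l\in\{1,\dots,k\}$ a state is $\mathcal X_l=(\mathbf M'_{l-1},\mathcal E_{\mathrm{rem}}^{(l-1)},\mathcal E_{\mathrm{used}}^{(l-1)},C_{\mathrm{rem}}^{(l-1)})$: current shifted Laplacian, remaining candidates, used candidates, remaining budget; $k_{\mathrm{rem}}^{(l-1)}:=k-|\mathcal E_{\mathrm{used}}^{(l-1)}|$. The initial state is $\mathcal X_1=(\mathbf M'_0,\mathcal E_{\mathrm c},\emptyset,C)$ with $\mathbf M'_0=\mathbf L_{\mathrm b}+\frac1n\mathbf 1\mathbf 1^\top$. Reserve and feasible actions. With $r=k_{\mathrm{rem}}^{(l-1)}$, $R_e^{(l)}$ is $w_{\min}$ times the sum of the $r-1$ smallest costs among edges of $\mathcal E_{\mathrm{rem}}^{(l-1)}\setminus\{e\}$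 ($R_e^{(l)}:=0$ when $r=1$). The feasible action set is $$\mathcal F_l:=\{e\in\mathcal E_{\mathrm{rem}}^{(l-1)}: c_ew_{\min}\le C_{\mathrm{rem}}^{(l-1)}-R_e^{(l)}\}.$$ Weights and gains. For $e\in\mathcal F_l$, with $s=C_{\mathrm{rem}}^{(l-1)}/k_{\mathrm{rem}}^{(l-1)}$, the reserve-capped trial weight is $$w_e^{(l)}=\min\Bigl\{\max\bigl\{w_{\min},\min\{w_{\max},s/c_e\}\bigr\},\frac{C_{\mathrm{rem}}^{(l-1)}-R_e^{(l)}}{c_e}\Bigr\},$$ and the one-step gain is $$\Delta R_{\mathrm{tot}}^{(l)}(e)=\frac{n\,w_e^{(l)}(b_e^2)^{(l)}}{1+w_e^{(l)}r_e^{(l)}},\quad r_e^{(l)}=\mathbf a_e^\top(\mathbf M'_{l-1})^{-1}\mathbf a_e,\quad (b_e^2)^{(l)}=\|(\mathbf M'_{l-1})^{-1}\mathbf a_e\|_2^2.$$ Transition. $f(\mathcal X_l,e)$, $e\in\mathcal F_l$, is the state $\mathcal X_{l+1}$ with $\mathbf M'_l=\mathbf M'_{l-1}+w_e^{(l)}\mathbf a_e\mathbf a_e^\top$, $\mathcal E_{\mathrm{rem}}^{(l)}=\mathcal E_{\mathrm{rem}}^{(l-1)}\setminus\{e\}$, $\mathcal E_{\mathrm{used}}^{(l)}=\mathcal E_{\mathrm{used}}^{(l-1)}\cup\{e\}$, $C_{\mathrm{rem}}^{(l)}=C_{\mathrm{rem}}^{(l-1)}-c_ew_e^{(l)}$.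 A state is reachable if it is obtained from $\mathcal X_1$ by successive transitions with feasible actions; the matrices $\mathbf M'_l$ are those occurring in reachable states (including $\mathbf M'_0$). Bellman-optimal value-to-go. $V_{k+1}:=0$; for $l\le k$, $V_l(\mathcal X_l)=0$ if $\mathcal F_l=\varnothing$ or $k_{\mathrm{rem}}^{(l-1)}=0$, and otherwise $$V_l(\mathcal X_l)=\max_{e\in\mathcal F_l}\{\Delta R_{\mathrm{tot}}^{(l)}(e)+V_{l+1}(f(\mathcal X_l,e))\}.$$ Local policy ratio. At a reachable state $\mathcal X_l$, $l\in\{1,\dots,k\}$, $\rho_l$ is defined when $\mathcal F_l\ne\varnothing$ and $k_{\mathrm{rem}}^{(l-1)}\ge1$, as the largest scalar in $[0,1]$ with $$\max_{e\in\mathcal F_l}\Delta R_{\mathrm{tot}}^{(l)}(e)\ge\frac{\rho_l}{k_{\mathrm{rem}}^{(l-1)}}V_l(\mathcal X_l).$$ *)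

(* Defs.v *)
From HB Require Import structures.
From mathcomp Require Import all_boot all_order all_algebra.
From mathcomp Require Import boolp classical_sets reals.

Set Implicit Arguments.
Unset Strict Implicit.
Unset Printing Implicit Defensive.

Import Order.TTheory GRing.Theory Num.Theory.
Local Open Scope ring_scope.

(* The element of S that bounds S from above (resp. below).  The value is 0
   if there is no such element; see largestP and smallestP. *)
Definition largest (R : realType) (S : set R) : R :=
  xget 0 (S `&` ubound S)%classic.
Definition smallest (R : realType) (S : set R) : R :=
  xget 0 (S `&` lbound S)%classic.

Lemma largestP (R : realType) (S : set R) (x : R) :
  S x -> (forall y, S y -> y <= x) -> largest S = x.
Proof.
move=> Sx ubx; apply: xget_unique; first by split.
by move=> y [Sy uby]; apply/eqP; rewrite eq_le ubx //=; apply: uby.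
Qed.

Lemma smallestP (R : realType) (S : set R) (x : R) :
  S x -> (forall y, S y -> x <= y) -> smallest S = x.
Proof.
move=> Sx lbx; apply: xget_unique; first by split.
by move=> y [Sy lby]; apply/eqP; rewrite eq_le [x <= y]lbx // andbT; apply: lby.
Qed.

Definition max_over (R : realType) (T : finType) (A : {set T}) (G : T -> R) : R :=
  largest [set x | exists2 e, e \in A & x = G e]%classic.

Lemma max_overP (R : realType) (T : finType) (A : {set T}) (G : T -> R) :
  A != finset.set0 ->
  exists2 e, e \in A & max_over A G = G e /\ forall f, f \in A -> G f <= G e.
Proof.
case/set0Pn=> e0 Ae0; case: (arg_maxP G Ae0) => e Ae le_e.
exists e => //; split=> //; apply: largestP; first by exists e.
by move=> _ [f Af ->]; apply: le_e.
Qed.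

Definition lambda_min (R : realType) (n : nat) (A : 'M[R]_n) : R :=
  smallest [set x | eigenvalue A x]%classic.
Definition lambda_max (R : realType) (n : nat) (A : 'M[R]_n) : R :=
  largest [set x | eigenvalue A x]%classic.

Definition sym_posdef (R : realType) (n : nat) (A : 'M[R]_n) : Prop :=
  A^T = A /\ forall x : 'cV[R]_n, x != 0 -> 0 < (x^T *m A *m x) 0 0.

(* An edge is a two-element set of nodes. *)
Notation edge n := {set 'I_n}.

(* v is the vector a_e for one of the two orientations of e. *)
Definition is_edge_vector (R : realType) (n : nat) (e : edge n) (v : 'cV[R]_n) :
    Prop :=
  exists i j : 'I_n,
    [/\ i != j, e = [set i; j]%SET & v = delta_mx i 0 - delta_mx j 0].

(* Weights, costs and edge vectors are functions on all sets of nodes; only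
   their values on base edges or candidate edges are constrained and used. *)
Record instance (R : realType) (n : nat) := Instance {
  base_edges : {set edge n};
  base_weight : edge n -> R;
  cand_edges : {set edge n};
  cost : edge n -> R;
  edge_vec : edge n -> 'cV[R]_n;
  budget : R;
  card_target : nat;
  wmin : R;
  wmax : R
}.

Record well_formed (R : realType) (n : nat) (P : instance R n) : Prop := WellFormed {
  base_edges_card : forall e, e \in base_edges P -> #|e| = 2%N;
  base_weight_gt0 : forall e, e \in base_edges P -> 0 < base_weight P e;
  cand_edges_card : forall e, e \in cand_edges P -> #|e| = 2%N;
  base_cand_disjoint : [disjoint base_edges P & cand_edges P];
  cost_gt0 : forall e, e \in cand_edges P -> 0 < cost P e;
  edge_vecP : forall e, e \in cand_edges P -> is_edge_vector e (edge_vec P e);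
  budget_gt0 : 0 < budget P;
  card_target_bounds : (1 <= card_target P <= #|cand_edges P|)%N;
  wmin_gt0 : 0 < wmin P;
  wmin_le_wmax : wmin P <= wmax P
}.

Definition base_laplacian (R : realType) (n : nat) (P : instance R n) : 'M[R]_n :=
  \matrix_(i, j)
    if i == j then \sum_(e in base_edges P | i \in e) base_weight P e
    else if [set i; j]%SET \in base_edges P then - base_weight P [set i; j]%SET
    else 0.

Definition initial_matrix (R : realType) (n : nat) (P : instance R n) : 'M[R]_n :=
  base_laplacian P + n%:R^-1 *: const_mx 1.

Definition max_matrix (R : realType) (n : nat) (P : instance R n) : 'M[R]_n :=
  initial_matrix P +
  wmax P *: \sum_(e in cand_edges P) edge_vec P e *m (edge_vec P e)^T.

Record state (R : realType) (n : nat) := State {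
  st_matrix : 'M[R]_n;
  st_rem : {set edge n};
  st_used : {set edge n};
  st_budget : R
}.

Section Process.

Context (R : realType) (n : nat) (P : instance R n).

Definition initial_state : state R n :=
  State (initial_matrix P) (cand_edges P) finset.set0 (budget P).

Definition k_rem (X : state R n) : nat := (card_target P - #|st_used X|)%N.

Definition reserve (X : state R n) (e : edge n) : R :=
  wmin P * \sum_(x <- take (k_rem X).-1
                       (sort <=%R [seq cost P f | f <- enum (st_rem X :\ e)])) x.

Definition feasible (X : state R n) : {set edge n} :=
  [set e in st_rem X | cost P e * wmin P <= st_budget X - reserve X e]%SET.

Definition trial_weight (X : state R n) (e : edge n) : R :=
  let s := st_budget X / (k_rem X)%:R in
  Num.min (Num.max (wmin P) (Num.min (wmax P) (s / cost P e)))
          ((st_budget X - reserve X e) / cost P e).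

Definition eff_resistance (X : state R n) (e : edge n) : R :=
  ((edge_vec P e)^T *m invmx (st_matrix X) *m edge_vec P e) 0 0.

Definition sq_norm_b (X : state R n) (e : edge n) : R :=
  \sum_(i < n) (invmx (st_matrix X) *m edge_vec P e) i 0 ^+ 2.

Definition gain (X : state R n) (e : edge n) : R :=
  n%:R * trial_weight X e * sq_norm_b X e /
  (1 + trial_weight X e * eff_resistance X e).

Definition transition (X : state R n) (e : edge n) : state R n :=
  State (st_matrix X + trial_weight X e *: (edge_vec P e *m (edge_vec P e)^T))
        (st_rem X :\ e) (e |: st_used X)
        (st_budget X - cost P e * trial_weight X e).

(* reachable l X: X occurs as the state X_l, 1 <= l <= k + 1; the matrix of
   X_l is M'_(l - 1). *)
Inductive reachable : nat -> state R n -> Prop :=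
| reachable_init : reachable 1 initial_state
| reachable_step (l : nat) (X : state R n) (e : edge n) :
    (l <= card_target P)%N -> reachable l X -> e \in feasible X ->
    reachable l.+1 (transition X e).

(* m is the number k + 1 - l of stages left. *)
Fixpoint value_stages_left (m : nat) (X : state R n) : R :=
  if m is m'.+1 then
    if (feasible X == finset.set0) || (k_rem X == 0%N) then 0
    else max_over (feasible X)
           (fun e => gain X e + value_stages_left m' (transition X e))
  else 0.

Definition value_to_go (l : nat) (X : state R n) : R :=
  value_stages_left ((card_target P).+1 - l)%N X.

(* Meaningful when feasible X is nonempty and 0 < k_rem X. *)
Definition policy_ratio (l : nat) (X : state R n) : R :=
  largest [set rho : R | 0 <= rho <= 1 /\
    rho / (k_rem X)%:R * value_to_go l X <= max_over (feasible X) (gain X)]%classic.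

End Process.

(* Main.v *)
(* Every feasible trial weight lies in [wmin, wmax], so in the Loewner order the
   matrix M of a reachable state lies between M'_0 and M'_max.  Writing l and L
   for the extreme eigenvalues lambda_min(M'_0) and lambda_max(M'_max), and
   using |a_e|^2 = 2, one gets 2 / L^2 <= |M^-1 a_e|^2 <= 2 / l^2 and
   a_e^T M^-1 a_e <= 2 / l.  Hence each one-step gain, at any reachable state
   and for any feasible edge, lies between n wmin (2 / L^2) / (1 + 2 wmax / l)
   and G = n wmax (2 / l^2), and the lower bound is exactly rho_min G.  As at
   most k_rem gains remain to be collected, V_l <= k_rem G, so already the
   trivial lower bound on the best gain is at least rho_min V_l / k_rem. *)

Require Import Defs.
From HB Require Import structures.
From mathcomp Require Import all_boot all_order all_algebra.
From mathcomp Require Import boolp classical_sets reals.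
From mathcomp Require Import ring lra.

Import Order.TTheory GRing.Theory Num.Theory.
Local Open Scope ring_scope.

(** * Bilinear forms of square matrices and Cauchy-Schwarz *)

Definition mxform {R : realType} {n : nat} (A : 'M[R]_n) (x y : 'cV[R]_n) : R :=
  (x^T *m A *m y) 0 0.

(** A notation rather than a definition, so that the lemmas on [mxform] apply to inner products as
    they stand. *)
Notation dotmx := (mxform 1%:M).

Section Forms.

Context {R : realType} {n : nat}.
Implicit Types (A B : 'M[R]_n) (x y z : 'cV[R]_n).

Lemma mxformDl A x y z : mxform A (x + y) z = mxform A x z + mxform A y z.
Proof. by rewrite /mxform linearD /= !mulmxDl mxE. Qed.

Lemma mxformDr A x y z : mxform A z (x + y) = mxform A z x + mxform A z y.
Proof. by rewrite /mxform mulmxDr mxE. Qed.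

Lemma mxformZl A a x y : mxform A (a *: x) y = a * mxform A x y.
Proof. by rewrite /mxform linearZ /= -!scalemxAl mxE. Qed.

Lemma mxformZr A a x y : mxform A x (a *: y) = a * mxform A x y.
Proof. by rewrite /mxform -scalemxAr mxE. Qed.

Lemma mxformD A B x y : mxform (A + B) x y = mxform A x y + mxform B x y.
Proof. by rewrite /mxform mulmxDr mulmxDl mxE. Qed.

Lemma mxformZ A a x y : mxform (a *: A) x y = a * mxform A x y.
Proof. by rewrite /mxform -scalemxAr -scalemxAl mxE. Qed.

Lemma mxformN A x y : mxform (- A) x y = - mxform A x y.
Proof. by rewrite -scaleN1r mxformZ mulN1r. Qed.

Lemma mxform_sum (I : finType) (S : {set I}) (F : I -> 'M[R]_n) x y :
  mxform (\sum_(i in S) F i) x y = \sum_(i in S) mxform (F i) x y.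
Proof. by rewrite /mxform mulmx_sumr mulmx_suml summxE. Qed.

Lemma mxformE A x y : mxform A x y = dotmx x (A *m y).
Proof. by rewrite /mxform mulmx1 mulmxA. Qed.

Lemma mxformC A x y : A^T = A -> mxform A x y = mxform A y x.
Proof.
move=> symA; rewrite /mxform; transitivity ((x^T *m A *m y)^T 0 0).
  by rewrite [RHS]mxE.
by rewrite !trmx_mul symA trmxK mulmxA.
Qed.

Lemma dotmxC x y : dotmx x y = dotmx y x.
Proof. by apply: mxformC; rewrite trmx1. Qed.

Lemma mxform_gram B x : mxform (B^T *m B) x x = dotmx (B *m x) (B *m x).
Proof. by rewrite /mxform trmx_mul mulmx1 !mulmxA. Qed.

Lemma mxform_rank1 (a x : 'cV[R]_n) : mxform (a *m a^T) x x = dotmx a x ^+ 2.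
Proof.
rewrite expr2 {1}dotmxC /mxform !mulmx1 mulmxA -mulmxA.
by rewrite [LHS]mxE big_ord1.
Qed.

Lemma dotmxxE x : dotmx x x = \sum_i x i 0 ^+ 2.
Proof.
by rewrite /mxform mulmx1 mxE; apply: eq_bigr => i _; rewrite mxE expr2.
Qed.

Lemma dotmxx_ge0 x : 0 <= dotmx x x.
Proof. by rewrite dotmxxE sumr_ge0 // => i _; apply: sqr_ge0. Qed.

Lemma dotmxx_eq0 x : (dotmx x x == 0) = (x == 0).
Proof.
apply/idP/eqP => [|->]; last by rewrite dotmxxE big1 // => i _; rewrite mxE expr0n.
rewrite dotmxxE psumr_eq0 => [/allP x0|i _]; last exact: sqr_ge0.
apply/colP => i; rewrite mxE; apply/eqP.
by rewrite -[_ == 0](expf_eq0 _ 2); apply: x0; rewrite mem_index_enum.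
Qed.

Lemma dotmxx_gt0 x : (0 < dotmx x x) = (x != 0).
Proof. by rewrite lt_def dotmxx_ge0 andbT dotmxx_eq0. Qed.

(** The form at [s *: x + t *: y] is nonnegative. For [c > 0], the choice [s = c], [t = - b] gives
    [c * (a * c - b ^+ 2) >= 0]. *)
Lemma psd_cauchy_schwarz A x y :
  A^T = A -> (forall z, 0 <= mxform A z z) ->
  mxform A x y ^+ 2 <= mxform A x x * mxform A y y.
Proof.
move=> symA psdA; have := psdA y.
set a := mxform A x x; set b := mxform A x y; set c := mxform A y y => c_ge0.
have quad s t : 0 <= s ^+ 2 * a + 2 * s * t * b + t ^+ 2 * c.
  have := psdA (s *: x + t *: y).
  rewrite mxformDl !mxformDr !mxformZl !mxformZr (mxformC A y x symA) -/a -/b -/c.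
  lra.
have a_ge0 : 0 <= a := psdA x.
have [c0|c_neq0] := eqVneq c 0; last first.
  have c_gt0 : 0 < c by rewrite lt_def c_neq0.
  have h := quad c (- b); rewrite -subr_ge0 -(pmulr_rge0 _ c_gt0).
  lra.
have [->|b_neq0] := eqVneq b 0; first by rewrite expr0n /= mulr_ge0.
(* With [c = 0] the quadratic is affine in [t]; if [b] were nonzero, this [t] would give it the
   value -1. *)
have := quad 1 (- (a + 1) / (2 * b)); rewrite c0 mulr0 addr0.
have -> : 1 ^+ 2 * a + 2 * 1 * (- (a + 1) / (2 * b)) * b = -1 by field.
by rewrite lerNr oppr0 ler10.
Qed.

Lemma dotmx_cauchy_schwarz x y : dotmx x y ^+ 2 <= dotmx x x * dotmx y y.
Proof. by apply: psd_cauchy_schwarz; [rewrite trmx1 | exact: dotmxx_ge0]. Qed.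

(** Each [|x_i x_j|] is at most the mean of [x_i^2] and [x_j^2], hence at most [dotmx x x]; the
    summand 1 makes [K] positive. *)
Lemma mxform_bounded A : exists2 K, 0 < K & forall x, mxform A x x <= K * dotmx x x.
Proof.
exists (1 + \sum_i \sum_j `|A i j|) => [|x].
  by rewrite ltr_wpDr // sumr_ge0 // => i _; rewrite sumr_ge0.
have coord i : x i 0 ^+ 2 <= dotmx x x.
  by rewrite dotmxxE (bigD1 i) //= lerDl sumr_ge0 // => j _; apply: sqr_ge0.
rewrite mulrDl mul1r ler_wpDl ?dotmxx_ge0 //; move: (dotmx x x) coord => D coord.
rewrite /mxform -mulmxA mxE mulr_suml ler_sum // => i _.
rewrite !mxE mulr_sumr mulr_suml ler_sum // => j _.
rewrite (le_trans (ler_norm _)) // mulrCA !normrM ler_wpM2l //.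
have := coord i; have := coord j; have := sqr_ge0 (`|x i 0| - `|x j 0|).
rewrite -(real_normK (num_real (x i 0))) -(real_normK (num_real (x j 0))).
nra.
Qed.

(* Cauchy-Schwarz for the form of [A], applied to [x] and [A *m x]. *)
Lemma psd_norm_mulmx A L x :
  A^T = A -> (forall z, 0 <= mxform A z z) ->
  (forall z, mxform A z z <= L * dotmx z z) ->
  dotmx (A *m x) (A *m x) <= L * mxform A x x.
Proof.
move=> symA psdA ubA; set y := A *m x.
have [y0|y_neq0] := eqVneq y 0.
  by rewrite [mxform A x x]mxformE -/y y0 /mxform !mulmx0 mxE mulr0.
have yy_gt0 : 0 < dotmx y y by rewrite dotmxx_gt0.
have := psd_cauchy_schwarz A y x symA psdA.
rewrite [mxform A y x]mxformE -/y expr2 => /le_trans CS.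
rewrite -(ler_pM2l yy_gt0) mulrCA mulrA.
by apply: CS; rewrite ler_wpM2r.
Qed.

End Forms.

(** * Extreme eigenvalues as bounds on the quadratic form *)

Section ExtremeEigenvalues.

Context {R : realType} {n : nat}.
Implicit Types (A : 'M[R]_n) (x : 'cV[R]_n).

(** Since [x] is the image of [A *m x] under the inverse, [|x|^2 <= K' |A x|^2 <= K' K x^T A x]. *)
Lemma psd_unitmx_coercive A :
  A^T = A -> (forall x, 0 <= mxform A x x) -> A \in unitmx ->
  exists2 eps, 0 < eps & forall x, eps * dotmx x x <= mxform A x x.
Proof.
move=> symA psdA unitA.
have [K K_gt0 ubK] := mxform_bounded A.
have [K' K'_gt0 ubK'] := mxform_bounded ((invmx A)^T *m invmx A).
exists (K' * K)^-1 => [|x]; first by rewrite invr_gt0 mulr_gt0.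
rewrite mulrC ler_pdivrMr ?mulr_gt0 // [_ * (_ * _)]mulrC -mulrA.
apply: le_trans (_ : K' * dotmx (A *m x) (A *m x) <= _); last first.
  by rewrite (ler_wpM2l (ltW K'_gt0)) // psd_norm_mulmx.
by have := ubK' (A *m x); rewrite mxform_gram mulKmx.
Qed.

Lemma exists_cV_neq0 : (0 < n)%N -> exists x, x != 0.
Proof.
move=> n_gt0; exists (delta_mx (Ordinal n_gt0) 0).
apply/eqP => /matrixP /(_ (Ordinal n_gt0) 0) /eqP.
by rewrite !mxE !eqxx oner_eq0.
Qed.

Lemma trmx_rV_neq0 (v : 'rV[R]_n) : (v^T != 0) = (v != 0).
Proof. by rewrite -(inj_eq trmx_inj) trmxK trmx0. Qed.

(** Eigenvectors are rows while forms take columns, hence the transposes. *)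
Lemma eigenvector_mxform A (v : 'rV[R]_n) a :
  v *m A = a *: v -> mxform A v^T v^T = a * dotmx v^T v^T.
Proof. by move=> vA; rewrite /mxform trmxK vA mulmx1 -scalemxAl mxE. Qed.

Lemma eigenvalue_ge A m a :
  (forall x, m * dotmx x x <= mxform A x x) -> eigenvalue A a -> m <= a.
Proof.
move=> lbA /eigenvalueP [v vA v_neq0].
have := lbA v^T; rewrite (eigenvector_mxform _ _ _ vA).
by rewrite ler_pM2r // dotmxx_gt0 trmx_rV_neq0.
Qed.

(* The largest [mu] such that [A - mu%:M] is positive semidefinite makes that
   matrix singular, since otherwise it would be coercive. *)
Lemma exists_least_eigenvalue A : (0 < n)%N -> A^T = A ->
  exists2 mu, eigenvalue A mu & forall x, mu * dotmx x x <= mxform A x x.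
Proof.
move=> n_gt0 symA.
pose S := [set m | forall x, m * dotmx x x <= mxform A x x]%classic.
have [K _ ubK] := mxform_bounded (- A).
have S_neq0 : (S !=set0)%classic.
  by exists (- K) => x; have := ubK x; rewrite mxformN mulNr lerNl.
have [u u_neq0] := exists_cV_neq0 n_gt0.
have ubS x : x != 0 -> ubound S (mxform A x x / dotmx x x).
  by move=> x_neq0 m Sm; rewrite ler_pdivlMr ?dotmxx_gt0.
(* Every Rayleigh quotient is an upper bound of [S], hence at least [sup S], so the supremum is
   attained. *)
have Smu : S (sup S).
  move=> x; have [->|x_neq0] := eqVneq x 0.
    by rewrite /mxform !mulmx0 mxE mulr0.
  rewrite -ler_pdivlMr ?dotmxx_gt0 //; apply: ge_sup => //; exact: ubS.
exists (sup S) => //; rewrite /eigenvalue /eigenspace kermx_eq0 row_free_unit.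
apply/negP => unitB.
have formB x : mxform (A - (sup S)%:M) x x = mxform A x x - sup S * dotmx x x.
  by rewrite mxformD mxformN -[(sup S)%:M]scalemx1 mxformZ.
have symB : (A - (sup S)%:M)^T = A - (sup S)%:M.
  by rewrite linearB /= tr_scalar_mx symA.
have psdB x : 0 <= mxform (A - (sup S)%:M) x x by rewrite formB subr_ge0; apply: Smu.
have [eps eps_gt0 lbB] := psd_unitmx_coercive _ symB psdB unitB.
(* Coercivity of the shifted matrix leaves room to raise [sup S] by [eps], a contradiction. *)
have : S (sup S + eps).
  by move=> x; have := lbB x; rewrite formB mulrDl lerBrDl.
move/ub_le_sup => /(_ (ex_intro _ _ (ubS u u_neq0))).
by rewrite gerDl leNgt eps_gt0.
Qed.

(** [smallest] falls back to 0 when no least element exists; the eigenvalue just constructed rules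
    this out. *)
Lemma lambda_min_rayleigh A : (0 < n)%N -> A^T = A ->
  eigenvalue A (lambda_min A) /\
  forall x, lambda_min A * dotmx x x <= mxform A x x.
Proof.
move=> n_gt0 symA; have [mu eig_mu lb_mu] := exists_least_eigenvalue A n_gt0 symA.
suff -> : lambda_min A = mu by [].
by apply: smallestP => // a eig_a; apply: (eigenvalue_ge A).
Qed.

(** The least eigenvalue of [- A] is the opposite of the largest one of [A]. *)
Lemma lambda_max_rayleigh A : (0 < n)%N -> A^T = A ->
  forall x, mxform A x x <= lambda_max A * dotmx x x.
Proof.
move=> n_gt0 symA.
have symNA : (- A)^T = - A by rewrite linearN /= symA.
have [mu eig_mu lb_mu] := exists_least_eigenvalue (- A) n_gt0 symNA.
have eigN B a : eigenvalue B a -> eigenvalue (- B : 'M[R]_n) (- a).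
  move=> /eigenvalueP [v vB v_neq0]; apply/eigenvalueP; exists v => //.
  by rewrite mulmxN vB scaleNr.
have -> : lambda_max A = - mu.
  apply: largestP => [|a eig_a]; first by have := eigN _ _ eig_mu; rewrite opprK.
  by rewrite lerNr (eigenvalue_ge (- A)) // eigN.
by move=> x; have := lb_mu x; rewrite mxformN mulNr lerNr.
Qed.

Lemma sym_posdef_unitmx A : sym_posdef A -> A \in unitmx.
Proof.
move=> [symA posA]; rewrite -row_free_unit -kermx_eq0; apply/rowV0P => v.
move=> /sub_kermxP vA; apply/eqP/negPn/negP => v_neq0.
have /posA : v^T != 0 by rewrite trmx_rV_neq0.
by rewrite trmxK vA mul0mx mxE ltxx.
Qed.

Lemma lambda_min_gt0 A : (0 < n)%N -> sym_posdef A -> 0 < lambda_min A.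
Proof.
move=> n_gt0 [symA posA].
have [/eigenvalueP [v vA v_neq0] _] := lambda_min_rayleigh A n_gt0 symA.
move: v_neq0; rewrite -trmx_rV_neq0 => v_neq0.
have := posA _ v_neq0; rewrite -/(mxform A v^T v^T) (eigenvector_mxform _ _ _ vA).
by rewrite pmulr_lgt0 // dotmxx_gt0.
Qed.

End ExtremeEigenvalues.

(** * Bounds on the inverse of a matrix from bounds on its form *)

Section InverseBounds.

Context {R : realType} {n : nat} (A : 'M[R]_n) (l L : R).
Context (symA : A^T = A) (unitA : A \in unitmx) (l_gt0 : 0 < l).
Context (lbA : forall x, l * dotmx x x <= mxform A x x).
Context (ubA : forall x, mxform A x x <= L * dotmx x x).

Lemma mxform_invmx (a : 'cV[R]_n) :
  mxform (invmx A) a a = mxform A (invmx A *m a) (invmx A *m a).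
Proof. by rewrite [LHS]mxformE [RHS]mxformE mulKVmx // dotmxC. Qed.

(** With [y = A^-1 a], [l |y|^2 <= y^T A y = y^T a <= |y| |a|]. The argument runs on squares, to
    avoid roots, and then cancels [|y|^2]. *)
Lemma invmx_norm_le (a : 'cV[R]_n) :
  l ^+ 2 * dotmx (invmx A *m a) (invmx A *m a) <= dotmx a a.
Proof.
set y := invmx A *m a.
have := dotmx_cauchy_schwarz y a; rewrite -{1}(mulKVmx unitA a) -/y -mxformE.
have := lbA y; have := dotmxx_ge0 y; have := dotmxx_ge0 a.
set d := dotmx y y; set c := dotmx a a; set q := mxform A y y => c0 d0 lq CS.
have [->|d_neq0] := eqVneq d 0; first by rewrite mulr0.
have d_gt0 : 0 < d by rewrite lt_def d_neq0.
rewrite -(ler_pM2l d_gt0); apply: le_trans CS.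
have ld0 : 0 <= l * d by rewrite mulr_ge0 // ltW.
have := ler_pM ld0 ld0 lq lq; lra.
Qed.

(** With [y = A^-1 a], [|a|^2 = |A y|^2 <= L y^T A y <= L^2 |y|^2]. *)
Lemma invmx_norm_ge (a : 'cV[R]_n) :
  dotmx a a <= L ^+ 2 * dotmx (invmx A *m a) (invmx A *m a).
Proof.
set y := invmx A *m a.
have psdA x : 0 <= mxform A x x.
  by apply: le_trans (lbA x); rewrite mulr_ge0 ?dotmxx_ge0 // ltW.
have := psd_norm_mulmx A L y symA psdA ubA; rewrite mulKVmx // => /le_trans; apply.
have [->|y_neq0] := eqVneq y 0; first by rewrite /mxform !mulmx0 mxE !mulr0.
(* The sign of [L] comes from the form at a nonzero [y], which lies between 0 and [L |y|^2]. *)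
have L_ge0 : 0 <= L.
  by rewrite -(pmulr_lge0 _ (_ : 0 < dotmx y y)) ?dotmxx_gt0 // (le_trans (psdA y)).
by rewrite expr2 -mulrA ler_wpM2l.
Qed.

Lemma invmx_form_ge0 (a : 'cV[R]_n) : 0 <= mxform (invmx A) a a.
Proof.
rewrite mxform_invmx; apply: le_trans (lbA _).
by rewrite mulr_ge0 ?dotmxx_ge0 // ltW.
Qed.

(** With [y = A^-1 a] and [r = a^T y], Cauchy-Schwarz gives [r^2 <= |a|^2 |y|^2] and coercivity
    gives [l |y|^2 <= r]; so [l r^2 <= |a|^2 r], and [r] cancels. *)
Lemma invmx_form_le (a : 'cV[R]_n) : l * mxform (invmx A) a a <= dotmx a a.
Proof.
have := invmx_form_ge0 a; have := lbA (invmx A *m a); rewrite -mxform_invmx.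
have := dotmx_cauchy_schwarz a (invmx A *m a); rewrite -mxformE.
have := dotmxx_ge0 a; set y := invmx A *m a.
set c := dotmx a a; set d := dotmx y y; set r := mxform _ a a => c0 CS ldr r0.
have [->|r_neq0] := eqVneq r 0; first by rewrite mulr0.
have r_gt0 : 0 < r by rewrite lt_def r_neq0.
rewrite -(ler_pM2r r_gt0); have := ler_wpM2l c0 ldr.
have := ler_wpM2l (ltW l_gt0) CS; lra.
Qed.

End InverseBounds.

(** * The ratio as a maximum, the norm of edge vectors, and scalar estimates *)

Lemma le_largest_ratio (R : realType) (c v b r : R) :
  0 <= b -> 0 <= r <= 1 -> r / c * v <= b ->
  r <= largest [set rho : R | 0 <= rho <= 1 /\ rho / c * v <= b]%classic.
Proof.
have swap x : x / c * v = x * (v / c) by rewrite mulrAC mulrA.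
rewrite swap; set a := v / c => b_ge0 r01 rab.
(* As [largest] defaults to 0, the maximum must be exhibited: it is 1 if [a <= b], and [b / a]
   otherwise. *)
have [ab|ab] := leP a b.
  rewrite (@largestP _ _ 1) => [|/=|y [/andP []]] //; first by case/andP: r01.
  by rewrite lexx ler01 swap mul1r.
have a_gt0 : 0 < a := le_lt_trans b_ge0 ab.
rewrite (@largestP _ _ (b / a)) => [|/=|y [_]].
- by rewrite ler_pdivlMr.
- rewrite divr_ge0 ?(ltW a_gt0) // ler_pdivrMr // mul1r (ltW ab) swap.
  by rewrite mulfVK ?gt_eqF.
- by rewrite swap ler_pdivlMr.
Qed.

Lemma dotmx_edge_vector (R : realType) (n : nat) (e : edge n) (a : 'cV[R]_n) :
  is_edge_vector e a -> dotmx a a = 2.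
Proof.
have dot_delta (i j : 'I_n) :
    dotmx (delta_mx i 0) (delta_mx j 0 : 'cV[R]_n) = (i == j)%:R.
  rewrite /mxform mulmx1 trmx_delta mul_delta_mx_cond.
  by case: (i == j); rewrite ?mulr1n ?mulr0n !mxE.
move=> [i [j [i_neq_j _ ->]]]; rewrite -scaleN1r.
rewrite mxformDl !mxformDr !mxformZl !mxformZr !dot_delta !eqxx.
by rewrite [j == i]eq_sym (negbTE i_neq_j) /=; ring.
Qed.

Lemma gain_formula_bounds (R : realType) (N w w0 w1 b r l L : R) :
  0 <= N -> 0 < w0 -> w0 <= w <= w1 -> 0 < l -> 0 < L ->
  2 / L ^+ 2 <= b <= 2 / l ^+ 2 -> 0 <= r <= 2 / l ->
  N * w0 * (2 / L ^+ 2) / (1 + 2 * w1 / l) <= N * w * b / (1 + w * r)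
  <= N * w1 * (2 / l ^+ 2).
Proof.
move=> N_ge0 w0_gt0 /andP [w_ge w_le] l_gt0 L_gt0 /andP [b_ge b_le].
move=> /andP [r_ge0 r_le]; have w_gt0 := lt_le_trans w0_gt0 w_ge.
have lowb_ge0 : 0 <= 2 / L ^+ 2 by rewrite divr_ge0 // exprn_ge0 // ltW.
have b_ge0 := le_trans lowb_ge0 b_ge.
have wr_ge0 : 0 <= w * r by rewrite mulr_ge0 // ltW.
have wr_le : w * r <= 2 * w1 / l.
  by rewrite [2 * _]mulrC -mulrA ler_pM // ltW.
apply/andP; split.
  (* Smallest numerator over largest denominator. *)
  apply: ler_pM.
  - by rewrite mulr_ge0 // mulr_ge0 // ltW.
  - by rewrite invr_ge0 addr_ge0 // (le_trans wr_ge0).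
  - by rewrite -[leLHS]mulrA -[leRHS]mulrA ler_wpM2l // ler_pM // ltW.
  - by rewrite lef_pV2 ?posrE ?lerD2l // ltr_wpDr // (le_trans wr_ge0).
rewrite ler_pdivrMr ?ltr_wpDr //.
have wb_le : N * w * b <= N * w1 * (2 / l ^+ 2).
  by rewrite -[leLHS]mulrA -[leRHS]mulrA ler_wpM2l // ler_pM // ltW.
apply: le_trans wb_le _; rewrite ler_peMr ?lerDl //.
have w1_ge0 := le_trans (ltW w_gt0) w_le.
by rewrite mulr_ge0 ?(mulr_ge0 N_ge0) // (le_trans b_ge0).
Qed.

(** The two facts about the constant: it is an admissible ratio, and it is the exact quotient of the
    lower and upper bounds on a gain. *)
Lemma rho_min_facts (R : realType) (N w0 w1 l L : R) :
  0 < w0 -> w0 <= w1 -> 0 < l -> l <= L ->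
  let rho := w0 / w1 * (l ^+ 2 / L ^+ 2) * (1 / (1 + 2 * w1 / l)) in
  0 <= rho <= 1 /\
  rho * (N * w1 * (2 / l ^+ 2)) = N * w0 * (2 / L ^+ 2) / (1 + 2 * w1 / l).
Proof.
move=> w0_gt0 w_le l_gt0 l_le_L rho.
have w1_gt0 := lt_le_trans w0_gt0 w_le; have L_gt0 := lt_le_trans l_gt0 l_le_L.
have den_ge1 : 1 <= 1 + 2 * w1 / l.
  by rewrite lerDl divr_ge0 ?mulr_ge0 // ltW.
have den_gt0 := lt_le_trans ltr01 den_ge1.
split; last first.
  by rewrite /rho; field; rewrite !gt_eqF //; nra.
have ratio01 : 0 <= w0 / w1 <= 1.
  by rewrite divr_ge0 ?(ltW w0_gt0) ?(ltW w1_gt0) //= ler_pdivrMr // mul1r.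
have cond01 : 0 <= l ^+ 2 / L ^+ 2 <= 1.
  rewrite divr_ge0 ?exprn_ge0 ?(ltW l_gt0) ?(ltW L_gt0) //=.
  by rewrite ler_pdivrMr ?exprn_gt0 // mul1r lerXn2r ?nnegrE // ltW.
have den01 : 0 <= 1 / (1 + 2 * w1 / l) <= 1.
  by rewrite divr_ge0 ?(ltW den_gt0) //= ler_pdivrMr // mul1r.
have mul01 (x y : R) : 0 <= x <= 1 -> 0 <= y <= 1 -> 0 <= x * y <= 1.
  by move=> /andP [? ?] /andP [? ?]; rewrite mulr_ge0 // mulr_ile1.
exact: mul01 (mul01 _ _ ratio01 cond01) den01.
Qed.

(** * Invariants of reachable states, and bounds on gains and values *)

Section PolicyRatio.

Context {R : realType} {n : nat} (P : instance R n).
Context (P_wf : well_formed P).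
Context (M_spd : forall (l : nat) (X : state R n),
  reachable P l X -> sym_posdef (st_matrix X)).

Implicit Types (X : state R n) (e : edge n).

Local Notation lmin := (lambda_min (initial_matrix P)).
Local Notation lmax := (lambda_max (max_matrix P)).

(** The bounds on the target cardinality force a candidate edge to exist, and its edge vector
    supplies a node. *)
Lemma nodes_gt0 : (0 < n)%N.
Proof.
have /andP [k_gt0 k_le] := card_target_bounds P_wf.
have /card_gt0P [e /(edge_vecP P_wf) [i _]] : (0 < #|cand_edges P|)%N.
  exact: leq_trans k_gt0 k_le.
exact: leq_ltn_trans (ltn_ord i).
Qed.

Lemma wmax_gt0 : 0 < wmax P.
Proof. exact: lt_le_trans (wmin_gt0 P_wf) (wmin_le_wmax P_wf). Qed.

(** Feasibility says exactly that the reserve cap is at least [wmin], so capping cannot push the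
    weight below it. *)
Lemma trial_weight_bounds X e :
  e \in cand_edges P -> e \in feasible P X -> wmin P <= trial_weight P X e <= wmax P.
Proof.
move=> /(cost_gt0 P_wf) c_gt0; rewrite inE => /andP [_ feas].
rewrite /trial_weight le_min le_max lexx /= ler_pdivlMr // mulrC feas /=.
by rewrite ge_min ge_max (wmin_le_wmax P_wf) ge_min lexx.
Qed.

Lemma reachable_edges {l X} : reachable P l X ->
  [/\ #|st_used X|.+1 = l, st_rem X \subset cand_edges P,
      st_used X \subset cand_edges P & [disjoint st_rem X & st_used X]].
Proof.
elim=> [|{}l {}X e _ _ [card_used sub_rem sub_used disj]] /=.
  by rewrite cards0 subxx finset.sub0set finset.disjoints_subset finset.setC0 finset.subsetT.
rewrite inE => /andP [e_rem _]; split.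
- by rewrite cardsU1 (disjointFr disj e_rem) add1n card_used.
- exact: fintype.subset_trans (finset.subD1set _ _) sub_rem.
- by rewrite finset.subUset finset.sub1set (fintype.subsetP sub_rem).
- rewrite finset.disjoints_subset; apply/fintype.subsetP => f; rewrite !inE.
  by case/andP=> /negbTE -> f_rem; rewrite (disjointFr disj f_rem).
Qed.

Lemma feasible_cand {l X e} :
  reachable P l X -> e \in feasible P X -> e \in cand_edges P.
Proof.
move=> /reachable_edges [_ /fintype.subsetP sub_rem _ _].
by rewrite inE => /andP [/sub_rem].
Qed.

(** A transition adds [w (a_e^T x)^2] with [0 <= w <= wmax]. Summing over used edges only makes the
    upper bound inductive. *)
Lemma reachable_mxform {l X} (x : 'cV[R]_n) : reachable P l X ->
  mxform (initial_matrix P) x x <= mxform (st_matrix X) x x <=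
  mxform (initial_matrix P) x x +
    wmax P * \sum_(e in st_used X) dotmx (edge_vec P e) x ^+ 2.
Proof.
elim=> [|{}l {}X e _ reachX /andP [lbX ubX] feas] /=.
  by rewrite big_set0 mulr0 addr0 lexx.
have [_ _ _ disj] := reachable_edges reachX.
have e_rem : e \in st_rem X by move: feas; rewrite inE => /andP [].
have /andP [w_ge w_le] := trial_weight_bounds X e (feasible_cand reachX feas) feas.
rewrite mxformD mxformZ mxform_rank1 big_setU1 ?(disjointFr disj e_rem) //=.
apply/andP; split.
  rewrite (le_trans lbX) // lerDl mulr_ge0 ?sqr_ge0 //.
  exact: le_trans (ltW (wmin_gt0 P_wf)) w_ge.
by rewrite mulrDr [leLHS]addrC [leRHS]addrCA lerD ?ler_wpM2r ?sqr_ge0.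
Qed.

Lemma max_matrix_mxform (x : 'cV[R]_n) : mxform (max_matrix P) x x =
  mxform (initial_matrix P) x x +
    wmax P * \sum_(e in cand_edges P) dotmx (edge_vec P e) x ^+ 2.
Proof.
rewrite mxformD mxformZ mxform_sum.
by congr (_ + _ * _); apply: eq_bigr => e _; rewrite mxform_rank1.
Qed.

(** Read off from the positive definiteness assumed at the first state. *)
Lemma initial_matrix_sym : (initial_matrix P)^T = initial_matrix P.
Proof. by case: (M_spd _ _ (reachable_init P)). Qed.

Lemma max_matrix_sym : (max_matrix P)^T = max_matrix P.
Proof.
rewrite /max_matrix linearD /= initial_matrix_sym linearZ /= linear_sum /=.
by congr (_ + _ *: _); apply: eq_bigr => e _; rewrite trmx_mul trmxK.
Qed.

Lemma lmin_gt0 : 0 < lmin.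
Proof. exact: lambda_min_gt0 nodes_gt0 (M_spd _ _ (reachable_init P)). Qed.

Lemma reachable_ge_lmin {l X} (x : 'cV[R]_n) : reachable P l X ->
  lmin * dotmx x x <= mxform (st_matrix X) x x.
Proof.
move=> /(reachable_mxform x) /andP [lbX _]; apply: le_trans lbX.
exact: (lambda_min_rayleigh _ nodes_gt0 initial_matrix_sym).2.
Qed.

Lemma reachable_le_lmax {l X} (x : 'cV[R]_n) : reachable P l X ->
  mxform (st_matrix X) x x <= lmax * dotmx x x.
Proof.
move=> reachX; have /andP [_ ubX] := reachable_mxform x reachX.
apply: le_trans (lambda_max_rayleigh _ nodes_gt0 max_matrix_sym x).
apply: le_trans ubX _; rewrite max_matrix_mxform lerD2l ler_pM2l ?wmax_gt0 //.
have [_ _ sub_used _] := reachable_edges reachX.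
(* Passing from used edges to all candidates only adds squares. *)
rewrite [leRHS](big_setID (st_used X)) /= (finset.setIidPr sub_used) lerDl.
by rewrite sumr_ge0 // => e _; rewrite sqr_ge0.
Qed.

(** Both bounds apply to the form of the initial matrix at one nonzero vector. *)
Lemma lmin_le_lmax : lmin <= lmax.
Proof.
have [x] := exists_cV_neq0 (R := R) nodes_gt0.
rewrite -dotmxx_gt0 => /ler_pM2r <-.
apply: le_trans (reachable_le_lmax x (reachable_init P)).
exact: reachable_ge_lmin x (reachable_init P).
Qed.

Lemma sq_norm_bE X e : sq_norm_b P X e =
  dotmx (invmx (st_matrix X) *m edge_vec P e) (invmx (st_matrix X) *m edge_vec P e).
Proof. by rewrite dotmxxE. Qed.

Lemma gain_bounds {l X e} : reachable P l X -> e \in feasible P X ->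
  n%:R * wmin P * (2 / lmax ^+ 2) / (1 + 2 * wmax P / lmin) <= gain P X e
  <= n%:R * wmax P * (2 / lmin ^+ 2).
Proof.
move=> reachX feas; have cand := feasible_cand reachX feas.
have aa := dotmx_edge_vector _ _ _ _ (edge_vecP P_wf cand).
have unitX := sym_posdef_unitmx _ (M_spd _ _ reachX).
have [symX _] := M_spd _ _ reachX.
have lbX x := reachable_ge_lmin x reachX.
have ubX x := reachable_le_lmax x reachX.
have l_gt0 := lmin_gt0; have L_gt0 := lt_le_trans l_gt0 lmin_le_lmax.
move: lmin lmax l_gt0 L_gt0 lbX ubX => l0 L0 l_gt0 L_gt0 lbX ubX.
have /andP [w_ge w_le] := trial_weight_bounds X e cand feas.
apply: gain_formula_bounds; rewrite ?ler0n ?(wmin_gt0 P_wf) ?w_ge //.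
(* The constant 2 is the squared norm of the edge vector, so the bounds on the inverse apply. *)
- rewrite ler_pdivrMr ?ler_pdivlMr ?exprn_gt0 // ![sq_norm_b P X e * _]mulrC.
  by rewrite sq_norm_bE -aa (invmx_norm_ge _ l0) // invmx_norm_le.
- apply/andP; split; first exact: (invmx_form_ge0 _ l0).
  by rewrite ler_pdivlMr // mulrC -aa; apply: invmx_form_le.
Qed.

(** Induction on the stages left: each stage adds at most [G], and an early stop has value 0. *)
Lemma value_le (G : R) : 0 <= G ->
  (forall l X e, reachable P l X -> e \in feasible P X -> gain P X e <= G) ->
  forall m l X, reachable P l X -> (m + l <= (card_target P).+1)%N ->
    value_stages_left P m X <= m%:R * G.
Proof.
move=> G_ge0 gain_le; elim=> [|m IHm] l X reachX ml /=; first by rewrite mul0r.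
case: ifPn => [_|]; first by rewrite mulr_ge0.
rewrite negb_or => /andP [F_neq0 _].
have [e feas [-> _]] := max_overP (fun e => gain P X e +
  value_stages_left P m (transition P X e)) F_neq0.
rewrite -natr1 mulrDl mul1r addrC lerD ?(gain_le l) // (IHm l.+1) ?addnS //.
(* With [m.+1] stages left, [ml] yields [l <= card_target P], as the transition requires. *)
by apply: reachable_step => //; apply: leq_trans (leq_addl m l) _.
Qed.

End PolicyRatio.

Theorem theorem7 (R : realType) (n : nat) (P : instance R n)
  (P_wf : well_formed P)
  (M_spd : forall (l : nat) (X : state R n),
     reachable P l X -> sym_posdef (st_matrix X)) :
  let lmin := lambda_min (initial_matrix P) in
  let lmax := lambda_max (max_matrix P) in
  0 < lmin /\
  forall (l : nat) (X : state R n),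
    (1 <= l <= card_target P)%N -> reachable P l X ->
    feasible P X != finset.set0 -> (1 <= k_rem P X)%N ->
    wmin P / wmax P * (lmin ^+ 2 / lmax ^+ 2) * (1 / (1 + 2 * wmax P / lmin))
      <= policy_ratio P l X.
Proof.
move=> lmin lmax.
have l_gt0 : 0 < lmin := lmin_gt0 P P_wf M_spd.
have l_le_L : lmin <= lmax := lmin_le_lmax P P_wf M_spd.
have gainP l X e : reachable P l X -> e \in feasible P X ->
    n%:R * wmin P * (2 / lmax ^+ 2) / (1 + 2 * wmax P / lmin) <= gain P X e
    <= n%:R * wmax P * (2 / lmin ^+ 2) := gain_bounds P P_wf M_spd.
clearbody lmin lmax.
split=> // l X l_bounds reachX F_neq0 k_gt0.
set rho := (X in X <= _).
have [rho01 rhoG] :=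
  rho_min_facts _ n%:R _ _ _ _ (wmin_gt0 P_wf) (wmin_le_wmax P_wf) l_gt0 l_le_L.
have G_ge0 : 0 <= n%:R * wmax P * (2 / lmin ^+ 2).
  rewrite mulr_ge0 ?divr_ge0 ?exprn_ge0 ?(ltW l_gt0) // mulr_ge0 //.
  exact: ltW (wmax_gt0 P P_wf).
set G := _ * (2 / lmin ^+ 2) in gainP rhoG G_ge0.
have V_le : value_to_go P l X <= (k_rem P X)%:R * G.
  have [card_used _ _ _] := reachable_edges P reachX.
  (* The state at stage [l] has used [l - 1] edges, so edges still to choose and stages left
     agree. *)
  have -> : k_rem P X = ((card_target P).+1 - l)%N by rewrite -card_used subSS.
  apply: (value_le P G G_ge0 _ _ l) => // [l' Y e reachY feas|].
    by have /andP [] := gainP _ _ _ reachY feas.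
  by rewrite subnK // leqW //; case/andP: l_bounds.
have [e feas [gain_e _]] := max_overP (gain P X) F_neq0.
have /andP [gain_ge _] := gainP _ _ _ reachX feas.
rewrite -rhoG -/rho in gain_ge.
have /andP [rho_ge0 _] := rho01.
apply: le_largest_ratio => //; rewrite gain_e.
  by apply: le_trans gain_ge; rewrite mulr_ge0.
(* [V_le] divided by [k_rem] and multiplied by [rho] reaches [rho * G], the lower bound on the
   gain. *)
apply: le_trans gain_ge; rewrite -mulrA ler_wpM2l // mulrC ler_pdivrMr ?ltr0n //.
by rewrite mulrC.
Qed.
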